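(* Let $(X,\mathcal{T})$ be a topological space with a semi-flow $\varphi$, and let $(\mathcal{X},\mathbf{cl},|\cdot|)$ be a Boolean CA-discretization of $(X,\mathcal{T})$ with specialization pre-order $\le$ and set of top cells $\mathcal{X}^\top$. Suppose $(\mathcal{X}^\top,\le^\top)$ is a pre-order, with closure operator $\mathbf{cl}^\top$ on subsets of $\mathcal{X}^\top$, satisfying $$\varphi\bigl(t,\mathrm{cl}|\xi|\bigr)\subset \mathrm{int}\,\bigl(\mathrm{cl}\,|\mathbf{cl}^\top\xi|\bigr)\qquad\text{for all } t>0 \text{ and all } \xi\in\mathcal{X}^\top.$$ Then the finite discretization $\mathrm{dyn}\colon(\mathcal{X},\le)\to(\mathsf{SC},\le)$ is given by $$\mathrm{dyn}(\xi)=\min_{\mathsf{SC}}\Bigl\{[\eta^\top]\;\Big|\;\eta^\top\in\mathcal{X}^\top,\ \xi\le\eta^\top\Bigr\},\qquad \xi\in\mathcal{X},$$ where $[\eta^\top]\in\mathsf{SC}$ is the partial equivalence class of $\eta^\top$ in $(\mathcal{X}^\top,\le^\top)$ (in particular this minimum exists).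
   Context: Semi-flow: a continuous map $\varphi\colon[0,\infty)\times X\to X$ with $\varphi(0,x)=x$, $\varphi(t,\varphi(s,x))=\varphi(t+s,x)$. $\mathrm{cl}$ and $\mathrm{int}$ denote closure and interior in $(X,\mathcal{T})$. CA-discretization: $\mathcal{X}$ is a finite set, $|\cdot|\colon \mathsf{Set}(\mathcal{X})\to\mathsf{Set}(X)$ is an injective Boolean homomorphism of power sets, $|\xi|:=|\{\xi\}|$, and $\mathbf{cl}$ is a (Kuratowski) closure operator on $\mathsf{Set}(\mathcal{X})$ with $\mathrm{cl}|\mathcal{U}|\subset|\mathbf{cl}\,\mathcal{U}|$ for all $\mathcal{U}\subset\mathcal{X}$. It is Boolean if $\mathrm{cl}|\mathcal{U}|=|\mathbf{cl}\,\mathcal{U}|$ for all $\mathcal{U}$. The specialization pre-order is $\xi\le\xi'$ iff $\xi\in\mathbf{cl}\{\xi'\}$. Top cells: $\xi\in\mathcal{X}^\top$ iff $\{\eta\in\mathcal{X}\mid\xi\le\eta\}=\{\xi\}$; it is assumed that $\mathbf{cl}\,\mathcal{X}^\top=\mathcal{X}$, i.e. every cell lies below some top cell. For $\mathcal{U}\subset\mathcal{X}^\top$, $\mathbf{cl}^\top\mathcal{U}=\{\xi\in\mathcal{X}^\top\mid\xi\le^\top\xi'\text{ for some }\xi'\in\mathcal{U}\}$, $\mathbf{cl}^\top\xi=\mathbf{cl}^\top\{\xi\}$. $(\mathsf{SC},\le)$ is the poset of partial equivalence classes of $(\mathcal{X}^\top,\le^\top)$: classes of $\xi\sim\xi'$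 iff $\xi\le^\top\xi'$ and $\xi'\le^\top\xi$, ordered by $[\xi]\le[\xi']$ iff $\xi\le^\top\xi'$. Write $\mathsf{O}(\cdot)$ for the bounded lattice of down-sets; $\mathsf{O}(\mathsf{SC})\cong\mathsf{O}(\mathcal{X}^\top,\le^\top)$ by taking unions of classes. Under the stated hypothesis the map $\mathcal{U}\mapsto\mathbf{cl}\,\mathcal{U}$ is an injective bounded lattice homomorphism $\mathsf{O}(\mathsf{SC})\cong\mathsf{O}(\mathcal{X}^\top,\le^\top)\to\mathsf{O}(\mathcal{X},\le)\subset\mathsf{Set}(\mathcal{X})$, and $\mathrm{dyn}$ is defined as its Birkhoff dual: $\mathrm{dyn}(\xi)$ is the minimum of all $\mathcal{S}\in\mathsf{SC}$ such that $\xi\in\mathbf{cl}\bigl(\bigcup_{\mathcal{S}'\le\mathcal{S}}\mathcal{S}'\bigr)$. *)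

(* Defs.v *)
From HB Require Import structures.
From mathcomp Require Import all_boot all_order all_algebra.
From mathcomp Require Import all_classical all_reals all_analysis.
Import Order.TTheory GRing.Theory Num.Theory.
Import numFieldNormedType.Exports.

Set Implicit Arguments.
Unset Strict Implicit.
Unset Printing Implicit Defensive.

(* Only the values [phi (t, x)] with [0 <= t] are constrained or used. *)
Record semiflow (R : realType) (X : topologicalType) (phi : R * X -> X) : Prop :=
  Semiflow {
    semiflow_cts :
      {within [set p : R * X | (0 <= p.1)%R]%classic, continuous phi}%classic;
    semiflow0 : forall x, phi (0%R, x) = x;
    semiflowD : forall (t s : R) x, (0 <= t)%R -> (0 <= s)%R ->
      phi (t, phi (s, x)) = phi ((t + s)%R, x) }.

Record kuratowski_closure (T : finType) (c : {set T} -> {set T}) : Prop :=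
  KuratowskiClosure {
    kcl0 : c finset.set0 = finset.set0;
    kcl_sub : forall U : {set T}, U \subset c U;
    kcl_idem : forall U, c (c U) = c U;
    kclU : forall U V, c (U :|: V) = c U :|: c V }.

Record boolean_hom (T : finType) (X : Type) (h : {set T} -> set X) : Prop :=
  BooleanHom {
    bhom0 : h finset.set0 = classical_sets.set0;
    bhomT : h [set: T] = classical_sets.setT;
    bhomU : forall U V, h (U :|: V) = (h U `|` h V)%classic;
    bhomI : forall U V, h (U :&: V) = (h U `&` h V)%classic;
    bhomC : forall U, h (~: U) = (~` h U)%classic }.

(* [creal U] is the subset |U| of X, and [ccl] the closure operator on cells. *)
Record ca_discretization (X : topologicalType) (K : finType) :=
  CADiscretization {
    creal : {set K} -> set X;
    ccl : {set K} -> {set K};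
    creal_hom : boolean_hom creal;
    creal_inj : injective creal;
    ccl_kuratowski : kuratowski_closure ccl;
    closure_creal : forall U, (closure (creal U) `<=` creal (ccl U))%classic }.

Section Cells.
Variables (X : topologicalType) (K : finType) (D : ca_discretization X K).

Definition boolean_ca : Prop := forall U, closure (creal D U) = creal D (ccl D U).

Definition spec_le : rel K := fun xi xi' => xi \in ccl D [set xi'].

Definition top_cells : {set K} :=
  [set xi | [set eta | spec_le xi eta] == [set xi]].

Definition top_cell : finType := {xi | xi \in top_cells}.

Definition cells_of (U : {set top_cell}) : {set K} := [set val xi | xi in U].

End Cells.

Record preorder_on (T : Type) := PreorderOn {
  pre_le :> rel T;
  pre_refl : reflexive pre_le;
  pre_trans : transitive pre_le }.

Section PartialEquivalenceClasses.
Variables (T : finType) (P : preorder_on T).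

Definition down_closure (U : {set T}) : {set T} :=
  [set xi | [exists xi' in U, P xi xi']].

Definition peclass (xi : T) : {set T} := [set xi' | P xi xi' && P xi' xi].

Definition SC : Type := {S : {set T} | S \in [set peclass xi | xi : T]}.

HB.instance Definition _ := Finite.on SC.

Lemma peclass_in xi : peclass xi \in [set peclass xi' | xi' : T].
Proof. exact: imset_f. Qed.

Definition SC_of (xi : T) : SC := exist _ (peclass xi) (peclass_in xi).

(* The relation between classes does not depend on the representatives: see
   [SC_of_le]. *)
Definition SC_le : rel SC := fun S S' =>
  [exists xi in val S, exists xi' in val S', P xi xi'].

Lemma SC_ofP (S : SC) : exists xi, S = SC_of xi.
Proof. by case: S => S HS; case/imsetP: (HS) => xi _ E; exists xi; apply: val_inj. Qed.

Lemma SC_of_le xi xi' : SC_le (SC_of xi) (SC_of xi') = P xi xi'.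
Proof.
apply/existsP/idP => [[a /andP[]]|h].
  rewrite inE => /andP[ha _] /existsP[b /andP[]]; rewrite inE => /andP[_ hb] hab.
  exact: pre_trans (pre_trans ha hab) hb.
exists xi; rewrite inE !pre_refl /=.
by apply/existsP; exists xi'; rewrite inE !pre_refl.
Qed.

Lemma SC_le_refl : reflexive SC_le.
Proof. by move=> S; have [xi ->] := SC_ofP S; rewrite SC_of_le pre_refl. Qed.

Lemma SC_le_trans : transitive SC_le.
Proof.
move=> S2 S1 S3; have [x1 ->] := SC_ofP S1; have [x2 ->] := SC_ofP S2.
by have [x3 ->] := SC_ofP S3; rewrite !SC_of_le; apply: pre_trans.
Qed.

Lemma SC_le_anti : antisymmetric SC_le.
Proof.
move=> S1 S2; have [x1 ->] := SC_ofP S1; have [x2 ->] := SC_ofP S2.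
rewrite !SC_of_le => /andP[h12 h21]; apply: val_inj; apply/setP=> z; rewrite !inE.
apply/andP/andP=> -[h h'].
  by split; [exact: pre_trans h21 h | exact: pre_trans h' h12].
by split; [exact: pre_trans h12 h | exact: pre_trans h' h21].
Qed.

HB.instance Definition _ := @Order.Le_isPOrder.Build Order.default_display SC
  SC_le SC_le_refl SC_le_anti SC_le_trans.

Definition SC_union (A : {set SC}) : {set T} := \bigcup_(S in A) val S.

End PartialEquivalenceClasses.

Definition is_minimum d (Q : porderType d) (A : pred Q) (m : Q) : Prop :=
  A m /\ forall x, A x -> (m <= x)%O.

(* [f] is the Birkhoff dual of a lattice map [h] from the down-sets of the poset
   [Q] to sets of cells: [f x] is the least [q] with [x] in the image of the
   principal down-set of [q].  [h] is only evaluated on down-sets. *)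
Definition birkhoff_dual d (Q : finPOrderType d) (K : finType)
    (h : {set Q} -> {set K}) (f : K -> Q) : Prop :=
  forall x, is_minimum (fun q => x \in h [set q' | (q' <= q)%O]) (f x).

Definition is_dyn (X : topologicalType) (K : finType) (D : ca_discretization X K)
    (P : preorder_on (top_cell D)) (dyn : K -> SC P) : Prop :=
  birkhoff_dual (fun A : {set SC P} => ccl D (cells_of (SC_union A))) dyn.

(* Main.v *)
(** Every top cell is open, so for sets [U], [V] of top cells
    [int (cl |U|) /\ int (cl |V|)] is contained in [cl |U /\ V|].  If
    [xi <= eta1] and [xi <= eta2] with [eta1], [eta2] top, the forward orbit of a
    point [x] of [|xi|] lies in both interiors for [t > 0]; letting [t] tend to
    [0] puts [x] in [cl |cl^T eta1 /\ cl^T eta2|], so some top [zeta >= xi] lies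
    below both [eta1] and [eta2].  Hence the classes of the top cells above [xi]
    form a nonempty down-directed subset of a finite poset, which therefore has a
    minimum. *)
Require Import Defs.
From mathcomp Require Import all_boot all_order all_algebra.
From mathcomp Require Import all_classical all_reals all_analysis.
Import Order.TTheory GRing.Theory Num.Theory.
Import numFieldNormedType.Exports.

Set Implicit Arguments.
Unset Strict Implicit.
Unset Printing Implicit Defensive.

(** Induction along the enumeration of [Q], keeping an element of [A] below every member of [A] met
    so far. A new member [p] is absorbed by replacing the current [m] with a common lower bound of
    [m] and [p] in [A]. *)
Lemma directed_minimum d (Q : finPOrderType d) (A : pred Q) :
  (exists q, A q) ->
  (forall p q, A p -> A q -> exists r, [/\ A r, (r <= p)%O & (r <= q)%O]) ->
  exists m, is_minimum A m.
Proof.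
move=> Aex Adir.
have [m [Am mle]] : exists m, A m /\ forall q, q \in enum Q -> A q -> (m <= q)%O.
  elim: (enum Q) => [|p s [m [Am mle]]]; first by have [q Aq] := Aex; exists q.
  case: (boolP (A p)) => [Ap|nAp].
    have [r [Ar rm rp]] := Adir _ _ Am Ap; exists r; split=> // q.
    by rewrite in_cons => /predU1P[->//|qs] /(mle _ qs); apply: le_trans.
  exists m; split=> // q; rewrite in_cons => /predU1P[->|/mle//].
  by rewrite (negPf nAp).
by exists m; split=> // q Aq; apply: mle => //; rewrite mem_enum.
Qed.

Section KuratowskiClosure.
Variables (T : finType) (c : {set T} -> {set T}).
Hypothesis c_kur : kuratowski_closure c.

Lemma kcl_mono (U V : {set T}) : U \subset V -> c U \subset c V.
Proof. by move=> /finset.setUidPr <-; rewrite (kclU c_kur) finset.subsetUl. Qed.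

(** [c] preserves finite unions and the empty set, so it is determined by its values on
    singletons. *)
Lemma mem_kcl (U : {set T}) x :
  reflect (exists2 y, y \in U & x \in c [set y]) (x \in c U).
Proof.
apply: (iffP idP) => [|[y yU]]; last first.
  by apply: (fintype.subsetP (kcl_mono _)); rewrite finset.sub1set.
have -> : c U = \bigcup_(y in U) c [set y].
  rewrite -(big_morph c (kclU c_kur) (kcl0 c_kur)); congr c.
  apply/setP=> z; apply/idP/finset.bigcupP => [zU|[y yU /finset.set1P->//]].
  by exists z => //; rewrite finset.set11.
by case/finset.bigcupP=> y yU xy; exists y.
Qed.

End KuratowskiClosure.

Lemma mem_boolean_hom (T : finType) (X : Type) (h : {set T} -> set X)
    (h_hom : boolean_hom h) (U : {set T}) x :
  h U x <-> exists2 k, k \in U & h [set k] x.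
Proof.
split=> [|[k kU hk]]; last first.
  have -> : U = [set k] :|: U.
    by apply/esym/finset.setUidPr; rewrite finset.sub1set.
  by rewrite (bhomU h_hom); left.
have -> : U = \bigcup_(k in U) [set k].
  apply/setP=> z; apply/idP/finset.bigcupP => [zU|[y yU /finset.set1P->//]].
  by exists z => //; rewrite finset.set11.
pose good (V : {set T}) := h V x -> exists2 k, k \in V & h [set k] x.
have: good (\bigcup_(k in U) [set k]); last by [].
apply: (big_ind good) => [|V W gV gW|k kU].
- by rewrite /good (bhom0 h_hom).
- rewrite /good (bhomU h_hom) => -[/gV|/gW] [k kin hk]; exists k => //;
    by rewrite finset.in_setU kin ?orbT.
- by move=> hk; exists k => //; rewrite finset.set11.
Qed.

Section Discretization.
Variables (X : topologicalType) (K : finType) (D : ca_discretization X K).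

Lemma creal_set1_neq0 (xi : K) : exists x, creal D [set xi] x.
Proof.
apply: contrapT => /forallNP none.
have /(@creal_inj _ _ D)/setP/(_ xi) :
    creal D [set xi] = creal D finset.set0.
  rewrite (bhom0 (creal_hom D)); apply/seteqP; split=> // x /none [].
by rewrite finset.set11 finset.in_set0.
Qed.

Lemma creal_set1_inj (xi eta : K) x :
  creal D [set xi] x -> creal D [set eta] x -> xi = eta.
Proof.
move=> hxi heta.
have : creal D ([set xi] :&: [set eta]) x by rewrite (bhomI (creal_hom D)).
case/(mem_boolean_hom (creal_hom D)) => k.
by rewrite finset.in_setI => /andP[/finset.set1P-> /finset.set1P->].
Qed.

Lemma mem_creal (U : {set K}) (xi : K) x :
  creal D [set xi] x -> creal D U x -> xi \in U.
Proof.
move=> hxi /(mem_boolean_hom (creal_hom D))[k kU hk].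
by rewrite (creal_set1_inj hxi hk).
Qed.

Lemma spec_le_trans : transitive (spec_le D).
Proof.
move=> eta xi zeta xieta etazeta; rewrite /spec_le -(kcl_idem (ccl_kuratowski D)).
by apply/(mem_kcl (ccl_kuratowski D)); exists eta.
Qed.

Lemma open_top_cell (eta : top_cell D) : open (creal D [set val eta]).
Proof.
have -> : creal D [set val eta] = (~` creal D (~: [set val eta]))%classic.
  by rewrite (bhomC (creal_hom D)) setCK.
apply: closed_openC => x /closure_creal; rewrite /= => hx.
suff <- : ccl D (~: [set val eta]) = ~: [set val eta] by [].
apply/eqP; rewrite finset.eqEsubset (kcl_sub (ccl_kuratowski D)) andbT.
apply/fintype.subsetP => z /(mem_kcl (ccl_kuratowski D))[y].
rewrite !finset.in_setC !finset.in_set1 => y_eta zy.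
(* If [z] were [eta], then [eta <= y], and maximality of the top cell [eta] would force
   [y = eta]. *)
apply: contraNneq y_eta => z_eta; rewrite -finset.in_set1.
have := valP eta; rewrite /top_cells finset.inE => /eqP <-.
by rewrite finset.inE /spec_le -z_eta.
Qed.

Lemma mem_creal_cells (U : {set top_cell D}) x :
  creal D (cells_of U) x <-> exists2 eta, eta \in U & creal D [set val eta] x.
Proof.
split=> [/(mem_boolean_hom (creal_hom D))[k /imsetP[eta etaU ->] h]|].
  by exists eta.
case=> eta etaU h; apply/(mem_boolean_hom (creal_hom D)).
by exists (val eta) => //; apply: imset_f.
Qed.

Lemma mem_ccl_cells (U : {set top_cell D}) xi :
  reflect (exists2 eta, eta \in U & spec_le D xi (val eta))
          (xi \in ccl D (cells_of U)).
Proof.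
apply: (iffP (mem_kcl (ccl_kuratowski D) _ _)) => [[k /imsetP[eta etaU ->] h]|].
  by exists eta.
by case=> eta etaU h; exists (val eta) => //; apply: imset_f.
Qed.

Lemma interior_closure_cellsI (U V : {set top_cell D}) :
  (interior (closure (creal D (cells_of U))) `&`
   interior (closure (creal D (cells_of V))) `<=`
   closure (creal D (cells_of (U :&: V))))%classic.
Proof.
move=> y [yU yV] N Ny.
have [z [/mem_creal_cells[eta etaU etaz] [Nz Vz]]] :
    (creal D (cells_of U) `&` (N `&` closure (creal D (cells_of V))) !=set0)%classic.
  (* [N] and [cl |V|] are both neighbourhoods of [y], so their intersection meets [|U|]. *)
  by apply: (interior_subset yU); apply: filterI.
have [w [/mem_creal_cells[zeta zetaV zetaw] etaw]] :
    (creal D (cells_of V) `&` creal D [set val eta] !=set0)%classic.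
  (* The cell of [eta] is an open neighbourhood of [z], which lies in [cl |V|]; hence it meets a
     cell of [V], and distinct cells are disjoint. *)
  by apply: Vz; apply: open_nbhs_nbhs; split=> //; apply: open_top_cell.
have eta_zeta : eta = zeta by apply: val_inj; apply: creal_set1_inj etaw zetaw.
exists z; split=> //; apply/mem_creal_cells; exists eta => //.
by rewrite finset.in_setI etaU eta_zeta.
Qed.

Lemma mem_ccl_SC_union (P : preorder_on (top_cell D)) (S : SC P) xi :
  (xi \in ccl D (cells_of (SC_union [set S' : SC P | (S' <= S)%O]))) <->
  exists2 eta, spec_le D xi (val eta) & (SC_of P eta <= S)%O.
Proof.
split=> [/mem_ccl_cells[eta /finset.bigcupP[S']]|[eta xieta etaS]].
  rewrite finset.inE => S'S; have [z S'E] := SC_ofP S'; rewrite {}S'E in S'S *.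
  rewrite finset.inE => /andP[_ eta_z] xieta; exists eta => //.
  by apply: le_trans S'S; rewrite /Order.le /= SC_of_le.
apply/mem_ccl_cells; exists eta => //; apply/finset.bigcupP.
by exists (SC_of P eta); rewrite finset.inE // !pre_refl.
Qed.

End Discretization.

(** Continuity at [(0, x)], where [phi] takes the value [x], yields a product neighbourhood [A * B]
    whose points with nonnegative time are sent into [N]. *)
Lemma semiflow_right_cvg (R : realType) (X : topologicalType) (phi : R * X -> X)
    (phi_semiflow : semiflow phi) (x : X) (N : set X) :
  nbhs x N -> exists2 t : R, (0 < t)%R & N (phi (t, x)).
Proof.
move=> Nx.
have /subspace_continuousP/(_ (0%R, x)) := semiflow_cts phi_semiflow.
rewrite /= /from_subspace (semiflow0 phi_semiflow) lexx => /(_ isT) /(_ N Nx).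
rewrite /= /within => -[[A B] /= [A0 Bx] AB].
have [e /= e0 eA] := A0.
(* Half the radius of a ball around 0 inside [A] is a positive time within that ball. *)
exists (e / 2)%R; first by rewrite divr_gt0.
apply: (AB (e / 2, x)%R) => /=; last by rewrite divr_ge0 // ltW.
split; last exact: nbhs_singleton.
apply: eA; rewrite /ball_ /= sub0r normrN ger0_norm ?divr_ge0 // ?ltW //.
by rewrite ltr_pdivrMr // ltr_pMr // ltr1n.
Qed.

Theorem theorem3p29 (R : realType) (X : topologicalType) (phi : R * X -> X)
    (phi_semiflow : semiflow phi)
    (K : finType) (D : ca_discretization X K) (D_boolean : boolean_ca D)
    (D_top : ccl D (top_cells D) = [set: K])
    (P : preorder_on (top_cell D))
    (P_dyn : forall (t : R) (xi : top_cell D), (0 < t)%R ->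
      ((fun x => phi (t, x)) @` closure (creal D [set val xi]) `<=`
        interior (closure (creal D (cells_of (down_closure P [set xi])))))%classic) :
  exists dyn : K -> SC P,
    [/\ is_dyn dyn,
        (forall xi xi' : K, spec_le D xi xi' -> (dyn xi <= dyn xi')%O) &
        forall xi : K,
          is_minimum
            (fun S : SC P => [exists eta : top_cell D,
               spec_le D xi (val eta) && (S == SC_of P eta)])
            (dyn xi)].
Proof.
pose above (xi : K) (S : SC P) :=
  [exists eta : top_cell D, spec_le D xi (val eta) && (S == SC_of P eta)].
have aboveP xi S :
    reflect (exists2 eta, spec_le D xi (val eta) & S = SC_of P eta) (above xi S).
  apply: (iffP existsP) => [[eta /andP[h /eqP->]]|[eta h ->]]; first by exists eta.
  by exists eta; rewrite h /=.
have min_above xi : exists m, is_minimum (above xi) m.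
  apply: directed_minimum => [|_ _ /aboveP[eta1 le1 ->] /aboveP[eta2 le2 ->]].
    have : xi \in ccl D (top_cells D) by rewrite D_top.
    case/(mem_kcl (ccl_kuratowski D)) => k ktop xik.
    by exists (SC_of P (Sub k ktop)); apply/aboveP; exists (Sub k ktop).
  have [x xix] := creal_set1_neq0 D xi.
  have x_cl eta : spec_le D xi (val eta) -> closure (creal D [set val eta]) x.
    move=> xieta; rewrite D_boolean; apply/(mem_boolean_hom (creal_hom D)).
    by exists xi.
  pose U eta := down_closure P [set eta].
  have : closure (creal D (cells_of (U eta1 :&: U eta2))) x.
    move=> N Nx.
    (* Aiming for the interior of [N] makes [N] a neighbourhood of [phi (t, x)] as well, so a point
       of the closure there suffices. *)
    have [t t0 Nt] := semiflow_right_cvg phi_semiflow (nbhs_interior Nx).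
    apply: interior_closure_cellsI Nt.
    by split; apply: (P_dyn t _ t0); exists x => //; apply: x_cl.
  (* Booleanness turns the topological closure back into a set of cells, which must contain [xi],
     the cell of [x]. *)
  rewrite D_boolean => /(mem_creal xix) /mem_ccl_cells[zeta].
  rewrite finset.in_setI !finset.inE => /andP[z1 z2] xizeta.
  have below eta : [exists xi' in [set eta], P zeta xi'] ->
      (SC_of P zeta <= SC_of P eta)%O.
    case/existsP=> _ /andP[/finset.set1P-> h].
    by rewrite /Order.le /= SC_of_le.
  exists (SC_of P zeta); split; [|exact: below|exact: below].
  by apply/aboveP; exists zeta.
have [dyn dynP] := choice min_above.
exists dyn; split=> // [xi|xi xi' xixi'].
  (* The predicate defining the dual is the up-closure of [above xi], so the minimum of [above xi]
     is also its minimum. *)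
  have [/aboveP[eta xieta dynE] dyn_le] := dynP xi; split.
    by apply/mem_ccl_SC_union; exists eta; rewrite ?dynE.
  move=> S /mem_ccl_SC_union[zeta xizeta]; apply: le_trans.
  by apply: dyn_le; apply/aboveP; exists zeta.
(* A top cell over [xi'] is also over [xi], so [dyn xi'] is a candidate in the minimum defining
   [dyn xi]. *)
have [/aboveP[eta xieta dynE] _] := dynP xi'.
apply: (dynP xi).2; apply/aboveP; exists eta => //.
exact: spec_le_trans xieta.
Qed.
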